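(* If $q$ is an odd prime power then \[ \mathrm{ex}(q^2-q-2, C_4) \geq \frac{1}{2}q^3 - q^2 - O(q^{3/4}), \] that is, there is an absolute constant $C>0$ such that for every odd prime power $q$ one has $\mathrm{ex}(q^2-q-2,C_4)\ge \frac12 q^3-q^2-Cq^{3/4}$.
   Context: For a graph $F$, the Turán number $\mathrm{ex}(n,F)$ is the maximum number of edges in an $n$-vertex (simple) graph that does not contain $F$ as a (not necessarily induced) subgraph. $C_4$ denotes the cycle on four vertices. *)

(* Defs.v *)
From mathcomp Require Import all_boot all_order all_algebra.
From mathcomp Require Import all_classical all_reals all_analysis.

Set Implicit Arguments.
Unset Strict Implicit.
Unset Printing Implicit Defensive.

Section Graphs.
Local Open Scope nat_scope.

(* A finite simple graph on the vertex type V is given by its edge set, a set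
   of two-element subsets of V. *)
Definition simple_graph (V : finType) (E : {set {set V}}) : bool :=
  [forall e in E, #|e| == 2].

(* Not necessarily induced: edges of F map to edges of E, non-edges are
   unconstrained. *)
Definition contains_subgraph (U V : finType)
    (E : {set {set V}}) (F : {set {set U}}) : bool :=
  [exists f : {ffun U -> V}, injectiveb f && [forall e in F, (f @: e) \in E]].

Definition turan_number (n : nat) (U : finType) (F : {set {set U}}) : nat :=
  \max_(E : {set {set 'I_n}} | simple_graph E && ~~ contains_subgraph E F) #|E|.

(* ordS is the successor modulo k; this is the cycle on k vertices for k >= 3. *)
Definition cycle_graph (k : nat) : {set {set 'I_k}} :=
  [set [set i; ordS i] | i : 'I_k].

Definition prime_power (q : nat) : Prop :=
  exists p k : nat, [/\ prime p, 0 < k & q = p ^ k].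

End Graphs.

(* Main.v *)
Require Import Defs.
From mathcomp Require Import all_boot all_order all_algebra all_field.
From mathcomp Require Import all_classical all_reals all_analysis.
From mathcomp Require Import zify ring lra.
From mathcomp Require Import fintype finset.

Set Implicit Arguments.
Unset Strict Implicit.
Unset Printing Implicit Defensive.

Import Order.TTheory GRing.Theory Num.Theory.
Local Open Scope ring_scope.

(** Fix a finite field F with q elements, q odd.  The polarity graph of the
projective plane over F has q^2+q+1 vertices, every vertex has q+1 neighbours
(itself among them for the q+1 absolute points), and two distinct vertices have
exactly one common neighbour, so it contains no 4-cycle.  Deleting a set S of
2q+3 vertices leaves q^2-q-2 vertices and loses (2q+3)(q+1) edges up to the
absolute points, minus the edges inside S.  So everything rests on choosing S
dense: it must span about 4.5q edges (lemma [turan_C4_delete]).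

The absolute points form a conic.  For a set T of m of them let S contain, for
all a, b in T, the pole [chord a b] of the line joining the points a and b; for
a = b it is the point a of the conic itself.  These are m + m(m-1)/2 vertices.  Each
pole of a secant is adjacent to its two contact points, which gives m(m-1)
edges; with m(m+1) close to 4q+6 this is almost 4q.  The rest comes from pairs
of secants: the poles of ab and cd are adjacent exactly when {a,b} and {c,d}
are harmonic conjugates, 2(ab+cd) = (a+b)(c+d).  Given a, b, c in general
position there is exactly one such d, so there are q(q-1)(q-3) harmonic
quadruples in F; averaging over the m-subsets (lemma [dense_subset]) yields a
T that contains at least m(m-1)(m-2)(m-3)/(q-2), about 16q, of them, hence
about 2q more edges (lemma [arcs_chords]).  The total, about 6q, exceeds the
4.5q that are needed by so much that for q >= 300 the bound q^3/2 - q^2 holds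
without any error term (lemma [turan_C4_large]); the error term is only used to
absorb the finitely many smaller q.

Edges are counted throughout as ordered pairs of adjacent vertices, loops
included. *)

(** * Finite counting *)

Section Counting.
Local Open Scope nat_scope.

Lemma card_le_fibers (A B : finType) (f : A -> B) (D : {set A}) (k : nat) :
  (forall x, x \in D -> #|[set y in D | f y == f x]| <= k) ->
  #|D| <= k * #|f @: D|.
Proof.
move=> fib; rewrite -sum1_card (partition_big_imset f) /= mulnC -sum_nat_const.
apply: leq_sum => _ /imsetP[x Dx ->].
apply: leq_trans (fib x Dx); rewrite -sum1_card.
by under [leqRHS]eq_bigl do rewrite inE.
Qed.

Lemma card_disjointU (V : finType) (A B : {set V}) :
  (forall x, x \in A -> x \notin B) -> #|A :|: B| = (#|A| + #|B|).
Proof.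
move=> dAB; rewrite cardsU disjoint_setI0 ?cards0 ?subn0 //.
by rewrite disjoints_subset; apply/subsetP => x xA; rewrite inE dAB.
Qed.

Lemma superset_card (V : finType) (A : {set V}) (k : nat) :
  #|A| <= k <= #|V| -> exists2 B : {set V}, A \subset B & #|B| = k.
Proof.
move=> /andP[Ak kV].
have : 0 < #|[set B : {set V} | B \subset ~: A & #|B| == k - #|A|]|.
  by rewrite cards_draws bin_gt0 [#|~: A|]cardsCs setCK; lia.
case/card_gt0P => B; rewrite inE => /andP[BA /eqP cB].
exists (A :|: B); first exact: subsetUl.
rewrite cardsU cB disjoint_setI0 ?cards0; first by lia.
by rewrite disjoint_sym disjoints_subset.
Qed.

(** Averaging, done one vertex at a time: in a set of t+1 vertices each
surviving [s i] avoids t+1-k of them, so deleting the best vertex keeps at least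
a fraction (t+1-k)/(t+1) of the family.  The product of these fractions is the
ratio of the two binomial coefficients. *)
Lemma dense_subset (V I : finType) (s : I -> {set V}) (D : {set I}) (k m : nat) :
  (forall i, i \in D -> #|s i| = k) -> m <= #|V| ->
  exists2 T : {set V}, #|T| = m &
    #|D| * 'C(m, k) <= #|[set i in D | s i \subset T]| * 'C(#|V|, k).
Proof.
move=> sk; set n := #|V| => mn; rewrite -(subKn mn).
elim: (n - m) => [|j [T cT hT]].
  exists [set: V]; first by rewrite cardsT subn0.
  rewrite subn0 leq_mul2r; apply/orP; right; apply: subset_leq_card.
  by apply/subsetP => i Di; rewrite inE Di subsetT.
have [nj|jn] := leqP n j.
  by exists T; rewrite ?cT; [lia|have -> : n - j.+1 = n - j by lia].
set t := n - j.+1; have et : n - j = t.+1 by lia.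
rewrite et in cT hT.
pose DT (S : {set V}) := [set i in D | s i \subset S].
(* Count the pairs (x, i) with x in T outside [s i], and [s i] inside T. *)
have sumDT : \sum_(x in T) #|DT (T :\ x)| = (t.+1 - k) * #|DT T|.
  under eq_bigr do rewrite -sum1_card.
  rewrite (exchange_big_dep (mem (DT T))) /=; last first.
    move=> x i xT; rewrite !inE => /andP[-> /=] h.
    exact: subset_trans h (subD1set _ _).
  rewrite mulnC -sum_nat_const; apply: eq_bigr => i.
  rewrite inE => /andP[Di sT].
  rewrite sum1_card -(sk _ Di) -cT.
  have -> : #|T| - #|s i| = #|T :\: s i| by rewrite cardsD (setIidPr sT).
  apply: eq_card => x; rewrite -[LHS]topredE /= !inE Di subsetD1 sT /=.
  exact: andbC.
have [x xT hx] : exists2 x, x \in T & (t.+1 - k) * #|DT T| <= t.+1 * #|DT (T :\ x)|.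
  apply/exists_inP; apply: contraT; rewrite negb_exists_in => /forall_inP hlt.
  suff : \sum_(x in T) t.+1 * #|DT (T :\ x)| < \sum_(x in T) (t.+1 - k) * #|DT T|.
    by rewrite -big_distrr /= sumDT sum_nat_const cT ltnn.
  have [x0 x0T] : exists x, x \in T by apply/card_gt0P; rewrite cT.
  rewrite (bigD1 x0) //= [ltnRHS](bigD1 x0) //= -addSn.
  apply: leq_add; first by rewrite ltnNge hlt.
  by apply: leq_sum => x /andP[xT _]; apply: ltnW; rewrite ltnNge hlt.
exists (T :\ x); first by have := cardsD1 x T; rewrite xT cT; lia.
rewrite -(leq_pmul2l (ltn0Sn t)).
have := mul_bin_down t.+1 k; rewrite /= => hb.
rewrite mulnCA hb mulnCA.
apply: (@leq_trans ((t.+1 - k) * (#|DT T| * 'C(n, k)))).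
  by rewrite leq_mul2l hT orbT.
by rewrite !mulnA leq_mul2r hx orbT.
Qed.

Lemma triangular_sandwich (N : nat) :
  exists m, m * m.+1 <= N < m.+1 * m.+2.
Proof.
elim: N => [|N [m hm]]; first by exists 0.
have [h|h] := leqP (m.+1 * m.+2) N.+1; last by exists m; lia.
by exists m.+1; nia.
Qed.

End Counting.

(** * Deleting vertices from a regular graph *)

Section Arcs.
Local Open Scope nat_scope.
Variables (V : finType) (e : rel V).

Definition arcs (X Y : {set V}) : {set V * V} :=
  [set p | [&& p.1 \in X, p.2 \in Y & e p.1 p.2]].

Lemma arcsUl (X X' Y : {set V}) : [disjoint X & X'] ->
  #|arcs (X :|: X') Y| = #|arcs X Y| + #|arcs X' Y|.
Proof.
move=> dX; rewrite -card_disjointU.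
  by apply: eq_card => p; rewrite !inE; case: (p.1 \in X); case: (p.1 \in X');
     case: (_ \in Y); case: (e _ _).
move=> p; rewrite !inE => /and3P[pX _ _].
by rewrite (disjointFr dX pX).
Qed.

Lemma arcs_swap (X Y : {set V}) : symmetric e -> #|arcs X Y| = #|arcs Y X|.
Proof.
move=> sym; have swapI : injective (fun p : V * V => (p.2, p.1)) by move=> [x y] [x' y'] [-> ->].
rewrite -(card_imset _ swapI); apply: eq_card => p.
apply/imsetP/idP => [[[x y]]|].
  by rewrite !inE /= => /and3P[xX yY exy] ->; rewrite /= yY xX sym.
case: p => x y; rewrite !inE /= => /and3P[xX yY exy].
by exists (y, x); rewrite ?inE //= yY xX sym.
Qed.

Lemma arcs_regular (d : nat) (X : {set V}) :
  (forall x, #|[set y | e x y]| = d) -> #|arcs X [set: V]| = #|X| * d.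
Proof.
move=> reg; rewrite -sum_nat_const -sum1_card.
rewrite (partition_big fst (mem X)) /=; last by move=> p; rewrite inE => /and3P[].
apply: eq_bigr => x xX; rewrite -(reg x) -[RHS]sum1_card.
rewrite (reindex_onto (fun y => (x, y)) snd) /=.
  by apply: eq_bigl => y; rewrite !inE /= xX !eqxx !andbT.
by move=> [x' y] /= /andP[_ /eqP->].
Qed.

(** Inclusion-exclusion on the arcs that meet S; an arc inside S is removed
twice by the two terms [#|S| * d], which is why dense sets are cheap to delete. *)
Lemma arcs_outside (d : nat) (S : {set V}) : symmetric e ->
  (forall x, #|[set y | e x y]| = d) ->
  #|arcs (~: S) (~: S)| + 2 * (#|S| * d) = #|V| * d + #|arcs S S|.
Proof.
move=> sym reg.
have dS : [disjoint ~: S & S] by rewrite disjoint_sym disjoints_subset setCK.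
have splitV X : #|arcs [set: V] X| = #|arcs (~: S) X| + #|arcs S X|.
  by rewrite -arcsUl // setUC setUCr.
have := splitV [set: V]; rewrite !(arcs_regular _ reg) cardsT.
have := splitV S; rewrite arcs_swap // (arcs_regular _ reg).
have := splitV (~: S); rewrite arcs_swap // (arcs_regular _ reg).
have := arcs_swap S (~: S) sym.
lia.
Qed.

End Arcs.

(** * From relations without 4-cycles to Turan numbers *)

Section Turan.
Local Open Scope nat_scope.

(** Loops of [e] are harmless: the vertices of a 4-cycle are distinct, so two
opposite ones would have the other two as distinct common neighbours. *)
Lemma turan_C4_arcs (V : finType) (e : rel V) (W : {set V}) :
  symmetric e ->
  (forall x y z w, x != y -> e x z -> e y z -> e x w -> e y w -> z = w) ->
  #|[set p in arcs e W W | p.1 != p.2]| <=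
    2 * turan_number #|W| (cycle_graph 4).
Proof.
move=> sym uniqN.
pose g (i : 'I_#|W|) : V := enum_val i.
have gI : injective g by exact: enum_val_inj.
pose A := [set p : 'I_#|W| * 'I_#|W| | (p.1 != p.2) && e (g p.1) (g p.2)].
pose E := [set [set p.1; p.2] | p in A].
have cA : #|[set p in arcs e W W | p.1 != p.2]| <= #|A|.
  apply: leq_trans (leq_imset_card (fun p => (g p.1, g p.2)) _).
  apply: subset_leq_card; apply/subsetP => -[x y].
  rewrite !inE /= => /andP[/and3P[xW yW exy] xy]; apply/imsetP.
  exists (enum_rank_in xW x, enum_rank_in xW y) => /=; last first.
    by rewrite /g !enum_rankK_in.
  rewrite inE /= /g !enum_rankK_in // exy andbT.
  by apply: contra xy => /eqP/(congr1 g); rewrite /g !enum_rankK_in // => ->.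
have cE : #|A| <= 2 * #|E|.
  apply: card_le_fibers; case=> i j _.
  apply: (@leq_trans #|[set (i, j); (j, i)]|); last by rewrite cards2; case: (_ != _).
  apply: subset_leq_card; apply/subsetP => -[k l].
  rewrite !inE /= -!andbA => /and3P[kl _ /eqP h].
  have hk : k \in [set i; j] by rewrite -h set21.
  have hl : l \in [set i; j] by rewrite -h set22.
  move: hk hl kl; rewrite !inE.
  by move=> /orP[]/eqP-> /orP[]/eqP->; rewrite ?eqxx ?orbT.
have simE : simple_graph E.
  apply/forall_inP => B /imsetP[[i j]]; rewrite inE /= => /andP[ij _] ->.
  by rewrite cards2 ij.
have Ee i j : i != j -> [set i; j] \in E -> e (g i) (g j).
  move=> ij /imsetP[[k l]]; rewrite inE /= => /andP[kl ekl] h.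
  have hi : i \in [set k; l] by rewrite -h set21.
  have hj : j \in [set k; l] by rewrite -h set22.
  move: hi hj ij; rewrite !inE.
  by move=> /orP[]/eqP-> /orP[]/eqP->; rewrite ?eqxx // sym.
have freeE : ~~ contains_subgraph E (cycle_graph 4).
  apply/negP => /existsP[f /andP[/injectiveP fI /forall_inP hf]].
  pose o k : 'I_4 := inord k.
  have step k l : k < 4 -> l < 4 -> k != l -> ordS (o k) = o l ->
      e (g (f (o k))) (g (f (o l))).
    move=> k4 l4 kl eS; apply: Ee.
      by rewrite (inj_eq fI) -val_eqE /= !inordK.
    have := hf _ (imset_f (fun i : 'I_4 => [set i; ordS i]) (isT : o k \in 'I_4)).
    by rewrite imsetU1 imset_set1 eS.
  have so k l : k < 4 -> l < 4 -> k.+1 %% 4 = l -> ordS (o k) = o l.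
    by move=> k4 l4 h; apply: val_inj; rewrite /= !inordK.
  have e01 := step 0 1 isT isT isT (so 0 1 isT isT erefl).
  have e12 := step 1 2 isT isT isT (so 1 2 isT isT erefl).
  have e23 := step 2 3 isT isT isT (so 2 3 isT isT erefl).
  have e30 := step 3 0 isT isT isT (so 3 0 isT isT erefl).
  have : g (f (o 1)) = g (f (o 3)).
    apply: (uniqN (g (f (o 0))) (g (f (o 2)))) => //; rewrite 1?sym //.
    by rewrite (inj_eq gI) (inj_eq fI) -val_eqE /= !inordK.
  by move=> /gI/fI/(congr1 val); rewrite /= !inordK.
apply: leq_trans cA (leq_trans cE _); rewrite leq_mul2l /=.
apply: (@leq_bigmax_cond _ _ (fun B : {set {set 'I_#|W|}} => #|B|)).
by rewrite simE freeE.
Qed.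

(** Regularity turns the count of surviving edges into a count of arcs inside
the deleted set.  All loops of the graph are charged at once, which costs at
most the number of absolute points. *)
Lemma turan_C4_delete (V : finType) (e : rel V) (d : nat) (S : {set V}) :
  symmetric e ->
  (forall x y z w, x != y -> e x z -> e y z -> e x w -> e y w -> z = w) ->
  (forall x, #|[set y | e x y]| = d) ->
  #|V| * d + #|arcs e S S| <=
    2 * turan_number (#|V| - #|S|) (cycle_graph 4)
      + 2 * (#|S| * d) + #|[set x | e x x]|.
Proof.
move=> sym uniqN reg.
rewrite -(arcs_outside S sym reg).
have := turan_C4_arcs (~: S) sym uniqN.
rewrite [#|~: S|]cardsCs setCK => h.
suff : #|arcs e (~: S) (~: S)| <=
    #|[set p in arcs e (~: S) (~: S) | p.1 != p.2]| + #|[set x | e x x]| by lia.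
rewrite -(card_imset [set x | e x x] (f := fun x => (x, x))); last by move=> x y [].
apply: leq_trans (leq_card_setU _ _).
apply: subset_leq_card; apply/subsetP => -[x y] h'.
rewrite 2!inE h' /=; case: (eqVneq x y) => //= exy.
move: h'; rewrite -exy inE => /and3P[_ _ exx].
by apply/imsetP; exists x; rewrite ?inE.
Qed.

End Turan.

(** * The polarity graph of the projective plane over a finite field *)

Section PolarityGraph.
Variable F : finFieldType.
Hypothesis two_neq0 : 2%:R != 0 :> F.
Implicit Types a b c d : F.

(** In homogeneous coordinates [inl (a, b)] is (1 : a : b), [inr (Some a)] is
(0 : 2 : a) and [inr None] is (0 : 0 : 1).  This normal form of
the points makes the vertex set a finite type without a quotient. *)
Definition polar_vertex : finType := ((F * F) + option F)%type.

(** Orthogonality for the form 2(x0 y2 + x2 y0) - x1 y1.  Its absolute points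
are the points (a, a^2/4) of a parabola and the point at infinity. *)
Definition polar (u v : polar_vertex) : bool :=
  match u, v with
  | inl (a, b), inl (c, d) => (b + d) * 2%:R == a * c
  | inl (a, _), inr (Some c) | inr (Some c), inl (a, _) => a == c
  | inr None, inr _ | inr _, inr None => true
  | _, _ => false
  end.

(** The polar line of [u], parametrised by the projective line over F; this is
what makes all degrees equal to q+1. *)
Definition polar_line (u : polar_vertex) (t : option F) : polar_vertex :=
  match u, t with
  | inl (a, b), Some c => inl (c, a * c / 2%:R - b)
  | inl (a, _), None => inr (Some a)
  | inr (Some c), Some b => inl (c, b)
  | inr (Some _), None => inr None
  | inr None, _ => inr t
  end.

Lemma card_polar_vertex : #|polar_vertex| = (#|F| ^ 2 + #|F| + 1)%N.
Proof. by rewrite card_sum card_prod card_option mulnn addnS addn1. Qed.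

Lemma polar_sym : symmetric polar.
Proof.
move=> [[a b]|[c|]] [[a' b']|[c'|]] //=.
by rewrite addrC [a * _]mulrC.
Qed.

Lemma polarE u v : polar u v = (v \in [set polar_line u t | t in [set: option F]]).
Proof.
apply/idP/imsetP => [|[t _ ->]]; last first.
  case: u t => [[a b]|[c|]] [t|] //=.
  by apply/eqP; field.
case: u v => [[a b]|[c|]] [[a' b']|[c'|]] //=.
- move=> /eqP h; exists (Some a'); rewrite ?in_setT //=.
  by rewrite -h mulfK // addrAC subrr add0r.
- by move=> /eqP ->; exists None; rewrite ?in_setT.
- by move=> /eqP ->; exists (Some b'); rewrite ?in_setT.
- by exists None; rewrite ?in_setT.
- by exists (Some c'); rewrite ?in_setT.
- by exists None; rewrite ?in_setT.
Qed.

Lemma polar_degree u : #|[set v | polar u v]| = #|F|.+1.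
Proof.
rewrite -card_option -cardsT -(card_imset [set: option F] (f := polar_line u)).
  by apply: eq_card => v; rewrite inE polarE.
by case: u => [[a b]|[c|]] [t|] [t'|] //= [->].
Qed.

Lemma polar_common_nbr u v z w : u != v ->
  polar u z -> polar v z -> polar u w -> polar v w -> z = w.
Proof.
have injr b y y' r : (b + y) * 2%:R == r -> (b + y') * 2%:R == r -> y = y'.
  by move=> /eqP<- /eqP/(mulIf two_neq0)/addrI.
have injl b b' y r : (b + y) * 2%:R == r -> (b' + y) * 2%:R == r -> b = b'.
  by move=> /eqP<- /eqP/(mulIf two_neq0)/addIr.
case: u v => [[a b]|[c|]] [[a' b']|[c'|]] uv;
  case: z => [[x y]|[s|]] //=; case: w => [[x' y']|[s'|]] //=;
  rewrite ?eqxx // => h1 h2 h3 h4.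
- have /eqP : (a - a') * (x - x') = 0.
    rewrite mulrBl !mulrBr -(eqP h1) -(eqP h2) -(eqP h3) -(eqP h4); ring.
  rewrite mulf_eq0 !subr_eq0 => /orP[]/eqP e; subst.
    by rewrite (injl _ _ _ _ h1 h2) eqxx in uv.
  by rewrite (injr _ _ _ _ h1 h3).
- have e : a = a' by rewrite (eqP h3) (eqP h4).
  by rewrite -e in h2 uv; rewrite (injl _ _ _ _ h1 h2) eqxx in uv.
- have e : a = a' by rewrite (eqP h1) (eqP h2).
  by rewrite -e in h4 uv; rewrite (injl _ _ _ _ h3 h4) eqxx in uv.
- by rewrite -(eqP h1) (eqP h3).
- rewrite (eqP h2) in h1 *; rewrite (eqP h4) in h3 *.
  by rewrite (injr _ _ _ _ h1 h3).
- by rewrite -(eqP h1) (eqP h3).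
- rewrite (eqP h1) in h2 *; rewrite (eqP h3) in h4 *.
  by rewrite (injr _ _ _ _ h2 h4).
- by rewrite -(eqP h1) -(eqP h2) eqxx in uv.
- by rewrite -(eqP h1) -(eqP h2) eqxx in uv.
- by rewrite -(eqP h3) -(eqP h4) eqxx in uv.
- by rewrite -(eqP h2) (eqP h4).
Qed.

Lemma polar_loops : (#|[set u | polar u u]| <= #|F|.+1)%N.
Proof.
pose loop (t : option F) : polar_vertex :=
  if t is Some a then inl (a, a * a / 2%:R / 2%:R) else inr None.
rewrite -card_option -cardsT; apply: leq_trans (leq_imset_card loop _).
apply: subset_leq_card; apply/subsetP => u; rewrite inE => uu; apply/imsetP.
case: u uu => [[a b] /= /eqP h|[c|] //= _]; last by exists None; rewrite ?in_setT.
exists (Some a); rewrite ?in_setT //= -h; congr (inl (_, _)).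
by field.
Qed.

(** * Poles of secants and harmonic quadruples *)

Definition harmonic a b c d : bool := (a * b + c * d) * 2%:R == (a + b) * (c + d).

(** The pole of the line through the absolute points (2a, a^2) and (2b, b^2);
for a = b it is the absolute point itself. *)
Definition chord a b : polar_vertex := inl (a + b, a * b).

Lemma polar_chord a b c d : polar (chord a b) (chord c d) = harmonic a b c d.
Proof. by []. Qed.

(** Vieta: the coordinates of [chord a b] are the elementary symmetric functions
of a and b. *)
Lemma chord_eq a b c d :
  chord a b = chord c d -> (a = c /\ b = d) \/ (a = d /\ b = c).
Proof.
case=> hs hp.
have /eqP : (c - a) * (c - b) = 0.
  have -> : (c - a) * (c - b) = c * c - c * (a + b) + a * b by ring.
  by rewrite hs hp; ring.
rewrite mulf_eq0 !subr_eq0 => /orP[]/eqP e; [left|right]; split=> //.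
- by rewrite e in hs; apply: addrI hs.
- by move: hs; rewrite e addrC; apply: addrI.
Qed.

Lemma polar_chord_tangent a b : polar (chord a b) (chord a a).
Proof. by rewrite polar_chord /harmonic; apply/eqP; ring. Qed.

Definition harmonic_quads : {set F * F * F * F} :=
  [set x | let: (a, b, c, d) := x in harmonic a b c d && uniq [:: a; b; c; d]].

Definition quad_support (x : F * F * F * F) : {set F} :=
  let: (a, b, c, d) := x in [set z in [:: a; b; c; d]].

Lemma card_quad_support x : x \in harmonic_quads -> #|quad_support x| = 4.
Proof.
case: x => [[[a b] c] d]; rewrite inE => /andP[_ u].
by rewrite /quad_support cardsE; apply/card_uniqP.
Qed.

Definition offdiag (T : {set F}) : {set F * F} :=
  [set p | [&& p.1 \in T, p.2 \in T & p.1 != p.2]].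

Lemma card_offdiag (T : {set F}) : #|offdiag T| = (#|T| * #|T|.-1)%N.
Proof.
rewrite -sum_nat_const -sum1_card.
under eq_bigl do rewrite inE.
rewrite -(pair_big_dep (mem T) (fun a b => (b \in T) && (a != b)) (fun _ _ => 1%N)) /=.
apply: eq_bigr => a aT; rewrite sum1_card (cardsD1 a T) aT /=.
by apply: eq_card => b; rewrite !inE andbC eq_sym.
Qed.

(** Three distinct points a, b, c have a fourth harmonic, given by a fraction
whose denominator vanishes exactly when c is the midpoint of a and b: its
fourth harmonic is then the point at infinity. *)
Lemma card_harmonic_quads :
  (#|F| * #|F|.-1 * (#|F| - 3) <= #|harmonic_quads|)%N.
Proof.
pose mid (p : F * F) := (p.1 + p.2) / 2%:R.
pose bad p : {set F} := [set p.1; p.2; mid p].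
pose triples := [set x : F * F * F | (x.1 \in offdiag setT) && (x.2 \notin bad x.1)].
pose fourth (x : F * F * F) : F * F * F * F :=
  let: (a, b, c) := x in
  (a, b, c, ((a + b) * c - 2%:R * a * b) / (2%:R * c - a - b)).
have fI : injective fourth by move=> [[a b] c] [[a' b'] c'] [-> -> ->].
have : (#|F| * #|F|.-1 * (#|F| - 3) <= #|triples|)%N.
  rewrite -cardsT -card_offdiag -sum_nat_const -[leqRHS]sum1_card.
  under [leqRHS]eq_bigl do rewrite inE.
  rewrite -(pair_big_dep (mem (offdiag setT)) (fun p c => c \notin bad p) (fun _ _ => 1%N)) /=.
  apply: leq_sum => p _; rewrite sum1_card.
  have -> : #|[pred c | c \notin bad p]| = #|~: bad p|.
    by apply: eq_card => c; rewrite !inE.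
  rewrite cardsCs setCK cardsT leq_sub2l // (leq_trans (leq_card_setU _ _)) //.
  by rewrite cards1 addn1 ltnS cards2; case: (_ != _).
move=> h; apply: leq_trans h _.
rewrite -(card_imset _ fI); apply: subset_leq_card.
apply/subsetP => _ /imsetP[[[a b] c] + ->].
rewrite !inE /mid /= !negb_or -!andbA => /and4P[ab ca cb cm].
set D := 2%:R * c - a - b; set N := (a + b) * c - _; set d := N / D.
have D0 : D != 0.
  apply: contra cm => /eqP hD; apply/eqP; apply: (mulIf two_neq0).
  by rewrite divfK // -[RHS]addr0 -hD /D; ring.
have dD : d * D = N by rewrite divfK.
have ca0 : c - a != 0 by rewrite subr_eq0.
have cb0 : c - b != 0 by rewrite subr_eq0.
have ab0 : a - b != 0 by rewrite subr_eq0.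
have neqd x : x * D - N != 0 -> (x == d) = false.
  by apply: contraNF => /eqP->; rewrite dD subrr.
(* It remains to see that d differs from c, b and a: at each of these points
   x * D - N factors into differences of a, b and c. *)
rewrite !neqd.
- rewrite ab [a == c]eq_sym ca [b == c]eq_sym cb /= andbT /harmonic -subr_eq0.
  have -> : (a * b + c * d) * 2%:R - (a + b) * (c + d) = d * D - N.
    by rewrite /D /N; ring.
  by rewrite dD subrr.
- have -> : c * D - N = 2%:R * ((c - a) * (c - b)) by rewrite /D /N; ring.
  by rewrite !mulf_neq0.
- have -> : b * D - N = - ((b - a) * (b - c)) by rewrite /D /N; ring.
  by rewrite oppr_eq0 mulf_neq0 // -opprB oppr_eq0.
- have -> : a * D - N = - ((a - b) * (a - c)) by rewrite /D /N; ring.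
  by rewrite oppr_eq0 mulf_neq0 // -opprB oppr_eq0.
Qed.

(** In the ratio of the falling factorials of m and q, the factors q(q-1)(q-3)
cancel against the number of harmonic quadruples. *)
Lemma harmonic_rich_subset (m : nat) : (3 < #|F|)%N -> (m <= #|F|)%N ->
  exists2 T : {set F}, #|T| = m &
    (m * m.-1 * (m - 2) * (m - 3) <=
      #|[set x in harmonic_quads | quad_support x \subset T]| * (#|F| - 2))%N.
Proof.
move=> F3 mF.
have [T cT hT] := dense_subset card_quad_support mF.
exists T => //; set h := #|_| in hT *.
have bin4 n : ('C(n, 4) * 24 = n * n.-1 * (n - 2) * (n - 3))%N.
  by rewrite (bin_ffact n 4) !ffactnS ffactn0 muln1 !mulnA -!subn1 -!subnDA.
set q := #|F| in F3 mF hT *.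
have := leq_mul card_harmonic_quads (leqnn 'C(m, 4)); rewrite -/q => h1.
have := leq_mul (leq_trans h1 hT) (leqnn 24).
rewrite -!mulnA !bin4 => h2.
have q0 : (0 < q * q.-1 * (q - 3))%N by rewrite !muln_gt0; lia.
by rewrite -(leq_pmul2l q0); move: h2; congr (_ <= _)%N; lia.
Qed.

(** * The dense set of poles *)

Definition chords (T : {set F}) : {set polar_vertex} :=
  [set chord p.1 p.2 | p in setX T T].

(** Unordered pairs suffice: the poles of proper secants are the images of the
2-subsets of T under sum and product. *)
Lemma card_chords (T : {set F}) : (#|chords T| <= 'C(#|T|.+1, 2))%N.
Proof.
pose diag := [set chord a a | a in T].
pose vieta (B : {set F}) : polar_vertex := inl (\sum_(x in B) x, \prod_(x in B) x).
pose secants := [set vieta B | B : {set F} in [set B : {set F} | B \subset T & #|B| == 2%N]].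
have sub : chords T \subset secants :|: diag.
  apply/subsetP => _ /imsetP[[a b] + ->]; rewrite !inE /= => /andP[aT bT].
  case: (eqVneq a b) => [<-|ab]; apply/orP; [right|left].
    by apply/imsetP; exists a.
  apply/imsetP; exists [set a; b].
    by rewrite inE cards2 ab subUset !sub1set aT bT.
  by rewrite /vieta !big_setU1 ?inE //= !big_set1.
apply: leq_trans (subset_leq_card sub) _.
apply: leq_trans (leq_card_setU _ _) _.
rewrite binS bin1 leq_add ?leq_imset_card //.
by rewrite -cards_draws leq_imset_card.
Qed.

(** Each ordered pair a <> b gives an arc from the pole of ab to the contact
point a and the reverse arc.  Arcs between poles of two secants come from
harmonic quadruples, where swapping a with b or c with d does not change the
arc, whence the factor 4. *)
Lemma arcs_chords (T : {set F}) :
  (8 * (#|T| * #|T|.-1) + #|[set x in harmonic_quads | quad_support x \subset T]|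
    <= 4 * #|arcs polar (chords T) (chords T)|)%N.
Proof.
pose X1 := [set (chord p.1 p.2, chord p.1 p.1) | p in offdiag T].
pose X2 := [set (chord p.1 p.1, chord p.1 p.2) | p in offdiag T].
set Q := [set x in harmonic_quads | _].
pose ends (x : F * F * F * F) :=
  let: (a, b, c, d) := x in (chord a b, chord c d).
pose X3 := ends @: Q.
have chordT a b : a \in T -> b \in T -> chord a b \in chords T.
  by move=> aT bT; apply/imsetP; exists (a, b); rewrite ?inE ?aT.
have QP a b c d : (a, b, c, d) \in Q ->
    [/\ harmonic a b c d, a != b, c != d & [/\ a \in T, b \in T, c \in T & d \in T]].
  rewrite !inE => /andP[/andP[-> /= u] /subsetP sT].
  have inT x : x \in [:: a; b; c; d] -> x \in T by move=> xs; apply: sT; rewrite inE.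
  split=> //; last by split; apply: inT; rewrite !inE eqxx ?orbT.
    by move: u; case: (eqVneq a b) => // ->; rewrite !inE eqxx.
  by move: u => /and4P[_ _]; rewrite inE.
have sub : X1 :|: X2 :|: X3 \subset arcs polar (chords T) (chords T).
  rewrite !subUset -andbA; apply/and3P; split; apply/subsetP => v /imsetP.
  - move=> [[a b]]; rewrite inE => /and3P[aT bT _] ->; rewrite inE.
    by rewrite !chordT // polar_chord_tangent.
  - move=> [[a b]]; rewrite inE => /and3P[aT bT _] ->; rewrite inE.
    by rewrite !chordT // polar_sym polar_chord_tangent.
  - move=> [[[[a b] c] d]] /QP[h _ _ [aT bT cT dT]] ->; rewrite inE.
    by rewrite !chordT.
have pair_inj a b c d : chord a a = chord c c -> chord a b = chord c d ->
    a = c /\ b = d.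
  move=> /chord_eq haa /chord_eq[//|[ad bc]].
  by case: haa => -[ac _]; split=> //; rewrite bc -ac ad.
have c1 : #|X1| = (#|T| * #|T|.-1)%N.
  rewrite -card_offdiag card_imset // => -[a b] [c d] /= e.
  by case: (pair_inj _ _ _ _ (congr1 snd e) (congr1 fst e)) => -> ->.
have c2 : #|X2| = (#|T| * #|T|.-1)%N.
  rewrite -card_offdiag card_imset // => -[a b] [c d] /= e.
  by case: (pair_inj _ _ _ _ (congr1 fst e) (congr1 snd e)) => -> ->.
have c3 : (#|Q| <= 4 * #|X3|)%N.
  apply: card_le_fibers; case=> [[[a b] c] d] _.
  pose s := [:: (a, b, c, d); (b, a, c, d); (a, b, d, c); (b, a, d, c)].
  apply: leq_trans (card_size s); apply: subset_leq_card.
  apply/subsetP => -[[[a' b'] c'] d']; rewrite inE => /andP[_ /eqP e].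
  have /chord_eq e1 : chord a' b' = chord a b := congr1 fst e.
  have /chord_eq e2 : chord c' d' = chord c d := congr1 snd e.
  by case: e1 e2 => -[-> ->] [] [-> ->]; rewrite !inE eqxx ?orbT.
have arith n x h y : (h <= 4 * x -> n + n + x <= y -> 8 * n + h <= 4 * y)%N by lia.
have := subset_leq_card sub.
rewrite !card_disjointU ?c1 ?c2; first exact: arith c3.
- move=> v /imsetP[[a b] + ->]; rewrite inE => /and3P[_ _ /= ab].
  apply/imsetP => -[[c d] _ /= /(congr1 fst) /chord_eq].
  by case=> -[ac bc]; rewrite ac bc eqxx in ab.
- move=> p /setUP[]/imsetP[[a b] _ ->]; apply/imsetP => -[[[[c d] c'] d']].
    move=> /QP[_ _ ne _] /(congr1 snd) /= /chord_eq.
    by case=> -[h1 h2]; rewrite -h1 -h2 eqxx in ne.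
  move=> /QP[_ ne _ _] /(congr1 fst) /= /chord_eq.
  by case=> -[h1 h2]; rewrite -h1 -h2 eqxx in ne.
Qed.

End PolarityGraph.

(** * Arithmetic and conclusion *)

(** If the conclusion failed, then h < 36q+24-8m(m-1).  As 4q < m^2+3m-4, this is
at most m^2+35m, so 4m(m-1)(m-2)(m-3) would be at most (m^2+35m)(m^2+3m), which
is false from m = 32 on (comparing 4m^4 with m^4). *)
Lemma chords_dense_enough (q m h : nat) : (300 <= q)%N ->
  (m * m.+1 <= 4 * q + 6 < m.+1 * m.+2)%N ->
  (m * m.-1 * (m - 2) * (m - 3) <= h * (q - 2))%N ->
  (4 * (9 * q + 6) <= 8 * (m * m.-1) + h)%N.
Proof.
move=> q300 /andP[qlo qhi] hM.
(* Shifting m by 32 turns the final inequality into one between polynomials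
   with nonnegative coefficients. *)
have m32 : (32 <= m)%N by rewrite leqNgt; apply/negP => m32; nia.
move: qlo qhi hM; rewrite -(subnK m32); set j := (m - 32)%N => qlo qhi hM.
rewrite leqNgt; apply/negP => hlt.
set m' := (j + 32)%N in qlo qhi hM hlt.
have e1 : (m'.-1 = j + 31)%N by rewrite /m'; lia.
have e2 : (m' - 2 = j + 30)%N by rewrite /m'; lia.
have e3 : (m' - 3 = j + 29)%N by rewrite /m'; lia.
rewrite e1 e2 e3 in hM hlt.
have hq : (4 * (q - 2) <= m' * (m' + 3))%N by nia.
have hh : (h <= m' * (m' + 35))%N by nia.
have : (4 * (m' * (j + 31) * (j + 30) * (j + 29)) <= (m' * (m' + 35)) * (m' * (m' + 3)))%N.
  apply: (@leq_trans (h * (4 * (q - 2)))); first by lia.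
  exact: leq_mul.
rewrite /m'; lia.
Qed.

(** The maximal m with m(m+1) <= 4q+6 is chosen, so that the poles number at
most 2q+3; S is completed by arbitrary vertices. *)
Lemma turan_C4_large (q : nat) : odd q -> prime_power q -> (300 <= q)%N ->
  (q ^ 3 <= 2 * q ^ 2 + 2 * turan_number (q ^ 2 - q - 2) (cycle_graph 4))%N.
Proof.
move=> oddq [p [k [p_pr k_gt0 qpk]]] q300.
have [F charF cF] := pPrimePowerField p_pr k_gt0; rewrite -qpk in cF.
have two_neq0 : 2%:R != 0 :> F.
  rewrite -(dvdn_pcharf charF); apply: contraL oddq => p2.
  have -> : q = (2 ^ k)%N by rewrite qpk (eqP (_ : p == 2%N)) // -dvdn_prime2.
  by rewrite oddX orbF -lt0n k_gt0.
have [m hm] := triangular_sandwich (4 * q + 6).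
have mF : (m <= #|F|)%N by rewrite cF; nia.
have F3 : (3 < #|F|)%N by rewrite cF; lia.
have [T cT hT] := harmonic_rich_subset two_neq0 F3 mF.
rewrite cF in hT.
have := arcs_chords two_neq0 T; rewrite cT.
set h := #|_| in hT *; set A := #|_| => hA.
have qq : (300 * q <= q ^ 2)%N by rewrite -mulnn leq_mul2r q300 orbT.
have dense := chords_dense_enough q300 hm hT.
have cV := card_polar_vertex F; rewrite cF in cV.
have [S chordsS cS] : exists2 S : {set polar_vertex F},
    chords T \subset S & #|S| = (2 * q + 3)%N.
  apply: superset_card; rewrite cV; apply/andP; split; last by lia.
  apply: leq_trans (card_chords T) _; rewrite cT.
  have := bin_ffact m.+1 2; rewrite !ffactnS ffactn0 muln1 /=.
  set c := 'C(_, _); change (2`!) with 2%N; lia.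
have arcsS : (A <= #|arcs (@polar F) S S|)%N.
  apply: subset_leq_card; apply/subsetP => x; rewrite !inE => /and3P[x1 x2 ->].
  by rewrite !(subsetP chordsS).
have := turan_C4_delete S (@polar_sym F) (polar_common_nbr two_neq0) (polar_degree two_neq0).
have := polar_loops two_neq0.
rewrite cV cS cF.
have -> : (q ^ 2 + q + 1 - (2 * q + 3) = q ^ 2 - q - 2)%N by lia.
set t := turan_number _ _; set l := #|[set u | _]|; set a := #|arcs _ _ _| in arcsS *.
move=> loops deleted.
have edges : (9 * q + 6 <= a)%N.
  rewrite -(leq_pmul2l (isT : 0 < 4)%N).
  by apply: leq_trans dense (leq_trans hA _); rewrite leq_mul2l arcsS.
move: deleted loops edges; rewrite [(q ^ 3)%N]expnSr -mulnn; clear.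
by move: t l a => t l a; lia.
Qed.

Theorem theorem1p1 (R : realType) :
  exists C : R, 0 < C /\
    forall q : nat, odd q -> prime_power q ->
      (turan_number (q ^ 2 - q - 2)%N (cycle_graph 4))%:R >=
        q%:R ^+ 3 / 2 - q%:R ^+ 2 - C * q%:R `^ (3 / 4).
Proof.
pose K : R := 300 ^+ 3; have K0 : 0 < K by rewrite exprn_gt0.
exists K; split=> // q oddq ppq.
have q1 : 1 <= q%:R :> R by rewrite ler1n; case: q oddq {ppq}.
have pow1 : 1 <= q%:R `^ (3 / 4) :> R.
  by rewrite -[leLHS](powRr0 q%:R) ler_powR // divr_ge0.
set x := q%:R `^ _ in pow1 *.
have Kx : K <= K * x by rewrite ler_peMr // ltW.
have [q300|q300] := leqP 300 q.
  have := turan_C4_large oddq ppq q300.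
  rewrite -(ler_nat R) natrD natrX natrM natrX natrM; set t := (turan_number _ _)%:R.
  by move: K K0 Kx => K K0 Kx; lra.
(* Here K * x alone exceeds q ^ 3, so the claimed bound is negative. *)
have qK : q%:R ^+ 3 <= K by rewrite lerXn2r ?nnegrE // ler_nat ltnW.
have q20 : 0 <= q%:R ^+ 2 :> R by rewrite exprn_ge0.
have q30 : 0 <= q%:R ^+ 3 :> R by rewrite exprn_ge0.
have := ler0n R (turan_number (q ^ 2 - q - 2) (cycle_graph 4)).
by move: K K0 Kx qK => K K0 Kx qK; lra.
Qed.
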